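(* Let $P$ be a finite poset. Then there exists a finite atomistic lattice $L$ such that $\mathrm{Con}\,L\cong \mathrm{H}(P)$ and $|\mathrm{J}(L)|=|P|+\alpha(P)$.
   Context: For a finite lattice $L$, $\mathrm{J}(L)$ denotes the set of all (nonzero) join-irreducible elements of $L$, and $\mathrm{Con}\,L$ is the congruence lattice of $L$. A finite lattice is atomistic if every element is a (finite, possibly empty) join of atoms. For a finite poset $P$, $\mathrm{H}(P)$ is the (distributive) lattice of hereditary subsets (down-sets) of $P$, ordered by inclusion. A spike of $P$ is a pair $\langle p,q\rangle$ of elements of $P$ such that $q$ is a maximal element of $P$ and $q$ is the unique element of $P$ that covers $p$. Define $\partial P=\{q\in P : \langle p,q\rangle \text{ is a spike of } P \text{ for some } p\in P\}$, $\partial_{\mathrm u}P=\{q\in P : \langle p,q\rangle \text{ is a spike of } P \text{ for a unique } p\in P\}$, $\partial_{\mathrm m}P=\partial P\setminus\partial_{\mathrm u}P$, and $\alpha(P)=|\partial_{\mathrm u}P|+2|\partial_{\mathrm m}P|$. *)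

(* Defs.v *)
From HB Require Import structures.
From mathcomp Require Import all_boot all_order.

Set Implicit Arguments.
Unset Strict Implicit.
Unset Printing Implicit Defensive.

Import Order.TTheory.
Local Open Scope order_scope.

Local Notation incl_display := Order.SetSubsetOrder.subset_display.

Section Posets.
Context {d : Order.disp_t} {P : finPOrderType d}.

Definition covers (x y : P) : bool := (x < y) && ~~ [exists z, x < z < y].

Definition maximal (q : P) : bool := ~~ [exists x, q < x].

Definition spike (p q : P) : bool :=
  [&& maximal q, covers p q & [forall r, covers p r ==> (r == q)]].

Definition hereditary (A : {set P}) : bool :=
  [forall x, forall y, (x \in A) && (y <= x) ==> (y \in A)].

Lemma hereditaryP (A : {set P}) :
  reflect (forall x y, x \in A -> y <= x -> y \in A) (hereditary A).
Proof.
apply: (iffP forallP) => [h x y xA yx | h x].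
  by have /forallP/(_ y) := h x; rewrite xA yx.
by apply/forallP => y; apply/implyP => /andP[xA yx]; apply: h xA yx.
Qed.

End Posets.

Section Spikes.
Context {d : Order.disp_t}.
Variable P : finPOrderType d.

Definition partial : {set P} := [set q | [exists p, spike p q]].

Definition partial_u : {set P} := [set q | #|[set p | spike p q]| == 1%N].

Definition partial_m : {set P} := partial :\: partial_u.

Definition alpha : nat := (#|partial_u| + 2 * #|partial_m|)%N.

Record Hered : predArgType := Downset {
  downset_set :> {set P};
  downset_hereditary : hereditary downset_set }.

HB.instance Definition _ := [isSub for downset_set].
HB.instance Definition _ := [Finite of Hered by <:].

Fact Hered_lt_def (A B : Hered) :
  (A \proper B) = (B != A) && (A \subset B).
Proof. by rewrite properEneq eq_sym. Qed.

Fact Hered_anti : antisymmetric (fun A B : Hered => A \subset B).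
Proof. by move=> A B; rewrite -eqEsubset => /eqP /val_inj. Qed.

HB.instance Definition _ := Order.isPOrder.Build incl_display Hered
  Hered_lt_def (fun A => subxx A) Hered_anti (fun B A C => @subset_trans P A B C).

Lemma leHered (A B : Hered) : (A <= B) = (A \subset B). Proof. by []. Qed.

Fact Hered_meet_proof (A B : Hered) : hereditary (A :&: B).
Proof.
apply/hereditaryP => x y /setIP[xA xB] yx; apply/setIP; split.
  by have /hereditaryP h := downset_hereditary A; apply: h xA yx.
by have /hereditaryP h := downset_hereditary B; apply: h xB yx.
Qed.

Fact Hered_join_proof (A B : Hered) : hereditary (A :|: B).
Proof.
apply/hereditaryP => x y /setUP[xA|xB] yx; apply/setUP.
  by left; have /hereditaryP h := downset_hereditary A; apply: h xA yx.
by right; have /hereditaryP h := downset_hereditary B; apply: h xB yx.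
Qed.

Fact Hered_bottom_proof : hereditary (set0 : {set P}).
Proof. by apply/hereditaryP => x y; rewrite inE. Qed.

Fact Hered_top_proof : hereditary [set: P].
Proof. by apply/hereditaryP => x y; rewrite !inE. Qed.

Fact Hered_lexI (A B C : Hered) :
  (A <= Downset (Hered_meet_proof B C)) = (A <= B) && (A <= C).
Proof. by rewrite !leHered subsetI. Qed.

Fact Hered_leUx (A B C : Hered) :
  (Downset (Hered_join_proof A B) <= C) = (A <= C) && (B <= C).
Proof. by rewrite !leHered subUset. Qed.

Fact Hered_le0x (A : Hered) : Downset Hered_bottom_proof <= A.
Proof. by rewrite leHered sub0set. Qed.

Fact Hered_lex1 (A : Hered) : A <= Downset Hered_top_proof.
Proof. by rewrite leHered subsetT. Qed.

HB.instance Definition _ :=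
  Order.POrder_isMeetSemilattice.Build incl_display Hered Hered_lexI.
HB.instance Definition _ :=
  Order.POrder_isJoinSemilattice.Build incl_display Hered Hered_leUx.
HB.instance Definition _ :=
  Order.hasBottom.Build incl_display Hered Hered_le0x.
HB.instance Definition _ :=
  Order.hasTop.Build incl_display Hered Hered_lex1.

End Spikes.

Section Lattices.
Context {d : Order.disp_t}.
Variable L : finTBLatticeType d.

Definition join_irreducible (x : L) : bool :=
  (x != \bot) &&
  [forall a, forall b, (x == a `|` b) ==> (x == a) || (x == b)].

Definition joinirr : {set L} := [set x | join_irreducible x].

Definition atom (a : L) : bool := covers \bot a.

Definition atomistic : Prop :=
  forall x : L, exists2 A : {set L},
    {in A, forall a, atom a} & x = \join_(a in A) a.

Definition congruence (r : {set L * L}) : bool :=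
  [&& [forall x, (x, x) \in r],
      [forall x, forall y, ((x, y) \in r) ==> ((y, x) \in r)],
      [forall x, forall y, forall z,
         ((x, y) \in r) && ((y, z) \in r) ==> ((x, z) \in r)] &
      [forall x, forall x', forall y, forall y',
         ((x, x') \in r) && ((y, y') \in r) ==>
         ((x `&` y, x' `&` y') \in r) && ((x `|` y, x' `|` y') \in r)]].

Lemma congruenceP (r : {set L * L}) :
  reflect [/\ forall x, (x, x) \in r,
              forall x y, (x, y) \in r -> (y, x) \in r,
              forall x y z, (x, y) \in r -> (y, z) \in r -> (x, z) \in r,
              forall x x' y y', (x, x') \in r -> (y, y') \in r ->
                (x `&` y, x' `&` y') \in r &
              forall x x' y y', (x, x') \in r -> (y, y') \in r ->
                (x `|` y, x' `|` y') \in r]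
          (congruence r).
Proof.
apply: (iffP and4P) => [[/forallP rr /forallP rs /forallP rt /forallP rc]
                       | [rr rs rt rI rU]].
  have rc' x x' y y' : (x, x') \in r -> (y, y') \in r ->
      (x `&` y, x' `&` y') \in r /\ (x `|` y, x' `|` y') \in r.
    move=> rx ry; apply/andP.
    by move/forallP/(_ x')/forallP/(_ y)/forallP/(_ y'): (rc x); rewrite rx ry.
  split=> //.
  - by move=> x y; apply/implyP; move/forallP: (rs x).
  - move=> x y z rxy ryz.
    by move/forallP/(_ y)/forallP/(_ z): (rt x); rewrite rxy ryz.
  - by move=> x x' y y' rx ry; case: (rc' _ _ _ _ rx ry).
  - by move=> x x' y y' rx ry; case: (rc' _ _ _ _ rx ry).
split; first exact/forallP.
- by apply/forallP => x; apply/forallP => y; apply/implyP/rs.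
- apply/forallP => x; apply/forallP => y; apply/forallP => z.
  by apply/implyP => /andP[]; apply: rt.
- apply/forallP => x; apply/forallP => x'; apply/forallP => y.
  by apply/forallP => y'; apply/implyP => /andP[rx ry]; rewrite rI ?rU.
Qed.

Record Con : predArgType := Congruence {
  con_set :> {set L * L};
  con_congruence : congruence con_set }.

HB.instance Definition _ := [isSub for con_set].
HB.instance Definition _ := [Finite of Con by <:].

Fact Con_lt_def (r s : Con) :
  (r \proper s) = (s != r) && (r \subset s).
Proof. by rewrite properEneq eq_sym. Qed.

Fact Con_anti : antisymmetric (fun r s : Con => r \subset s).
Proof. by move=> r s; rewrite -eqEsubset => /eqP /val_inj. Qed.

HB.instance Definition _ := Order.isPOrder.Build incl_display Con
  Con_lt_def (fun r => subxx r) Con_anti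
  (fun s r t => @subset_trans _ r s t).

Lemma leCon (r s : Con) : (r <= s) = (r \subset s). Proof. by []. Qed.

Lemma congruence_bigcap (Q : pred {set L * L}) :
  (forall t, Q t -> congruence t) -> congruence (\bigcap_(t | Q t) t).
Proof.
move=> hQ; apply/congruenceP; split.
- by move=> x; apply/bigcapP => t /hQ /congruenceP[].
- move=> x y /bigcapP h; apply/bigcapP => t Qt.
  by have /congruenceP[_ rs _ _ _] := hQ _ Qt; apply: rs (h _ Qt).
- move=> x y z /bigcapP h1 /bigcapP h2; apply/bigcapP => t Qt.
  by have /congruenceP[_ _ rt _ _] := hQ _ Qt; apply: rt (h1 _ Qt) (h2 _ Qt).
- move=> x x' y y' /bigcapP h1 /bigcapP h2; apply/bigcapP => t Qt.
  by have /congruenceP[_ _ _ rI _] := hQ _ Qt; apply: rI (h1 _ Qt) (h2 _ Qt).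
- move=> x x' y y' /bigcapP h1 /bigcapP h2; apply/bigcapP => t Qt.
  by have /congruenceP[_ _ _ _ rU] := hQ _ Qt; apply: rU (h1 _ Qt) (h2 _ Qt).
Qed.

Fact Con_meet_proof (r s : Con) : congruence (r :&: s).
Proof.
have -> : r :&: s = \bigcap_(t in [set val r; val s]) t.
  by rewrite bigcap_setU !big_set1.
by apply: congruence_bigcap => t /set2P[] ->; apply: con_congruence.
Qed.

(* The least congruence containing r and s. *)
Definition con_join (r s : Con) : {set L * L} :=
  \bigcap_(t | congruence t && (r :|: s \subset t)) t.

Fact Con_join_proof (r s : Con) : congruence (con_join r s).
Proof. by apply: congruence_bigcap => t /andP[]. Qed.

Fact Con_bottom_proof : congruence [set u | u.1 == u.2].
Proof.
apply/congruenceP; split.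
- by move=> x; rewrite inE.
- by move=> x y; rewrite !inE eq_sym.
- by move=> x y z; rewrite !inE => /eqP /= -> /eqP ->.
- by move=> x x' y y'; rewrite !inE => /eqP /= -> /eqP ->.
- by move=> x x' y y'; rewrite !inE => /eqP /= -> /eqP ->.
Qed.

Fact Con_top_proof : congruence [set: L * L].
Proof. by apply/congruenceP; split=> *; rewrite inE. Qed.

Fact Con_lexI (r s t : Con) :
  (r <= Congruence (Con_meet_proof s t)) = (r <= s) && (r <= t).
Proof. by rewrite !leCon subsetI. Qed.

Fact Con_leUx (r s t : Con) :
  (Congruence (Con_join_proof r s) <= t) = (r <= t) && (s <= t).
Proof.
rewrite !leCon -subUset; apply/idP/idP => /= h.
  by apply: subset_trans h; apply/bigcapsP => u /andP[].
by apply: bigcap_inf; rewrite con_congruence.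
Qed.

Fact Con_le0x (r : Con) : Congruence Con_bottom_proof <= r.
Proof.
rewrite leCon; apply/subsetP => -[x y]; rewrite inE => /eqP /= ->.
by have /congruenceP[rr _ _ _ _] := con_congruence r.
Qed.

Fact Con_lex1 (r : Con) : r <= Congruence Con_top_proof.
Proof. by rewrite leCon subsetT. Qed.

HB.instance Definition _ :=
  Order.POrder_isMeetSemilattice.Build incl_display Con Con_lexI.
HB.instance Definition _ :=
  Order.POrder_isJoinSemilattice.Build incl_display Con Con_leUx.
HB.instance Definition _ :=
  Order.hasBottom.Build incl_display Con Con_le0x.
HB.instance Definition _ :=
  Order.hasTop.Build incl_display Con Con_lex1.

End Lattices.

Definition lattice_isomorphic {d d' : Order.disp_t}
    (L : latticeType d) (M : latticeType d') : Prop :=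
  exists f : L -> M,
    [/\ bijective f, Order.meet_morphism f & Order.join_morphism f].

(* Main.v *)
Require Import Defs.
From HB Require Import structures.
From mathcomp Require Import all_boot all_order.

Set Implicit Arguments.
Unset Strict Implicit.
Unset Printing Implicit Defensive.

Import Order.TTheory.
Local Open Scope order_scope.

Local Notation incl_display := Order.SetSubsetOrder.subset_display.

(** Blow up the poset: let X be a finite set with a map h onto P, quasi-ordered
    by comparing images under h, and let L be the lattice of the subsets of X
    closed under the rule

      if x and y are distinct elements of C and z lies below both, then z is
      in C.

    Points are closed, so L is atomistic and its join-irreducible elements are
    the points: there are |X| of them.

    A congruence of L is determined by the set of points that it collapses to
    the bottom (con_collapsedE), because every closed set is the join of its
    points. Conversely every down-set A of X is collapsed by a congruence:
    identify C and D when they agree off A. This respects joins because a rule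
    with its conclusion outside A has its premises outside A (closure_mod).
    So Con L is isomorphic to the lattice of down-sets of X, which is H(P), as
    soon as the set of collapsed points is always a down-set (collapsed_le). To
    see that collapsing y forces collapsing a point x below y, one joins with a
    third point z above x: the rule puts x below y ∨ z, which is congruent
    to z, and x meets z in the bottom. The condition needed (the hypothesis
    third) is thus: any two distinct points x below y admit a third point z
    above x. In other words, no principal up-set of X has exactly two elements.

    In P itself the principal up-sets with exactly two elements are the {p, q}
    with <p, q> a spike. To remove these, if <p, q> is the only spike ending
    in q, then p is given one extra copy; if several spikes end in q, then it
    is q that is given two extra copies. This costs alpha(P) points
    (card_blowup), and blowup_third checks the condition. *)

(** * The lattice of closed sets *)

Section ClosedSets.
Context {d : Order.disp_t} {P : finPOrderType d} {X : finType}.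
Variable h : X -> P.

(** The pair x, y generates every other point below both; requiring x != y
    keeps singletons closed. *)
Definition closed_under (C : {set X}) : bool :=
  [forall x, forall y, forall z,
     [&& x \in C, y \in C, x != y, h z <= h x & h z <= h y] ==> (z \in C)].

Lemma closed_underP (C : {set X}) :
  reflect (forall x y z, x \in C -> y \in C -> x != y ->
             h z <= h x -> h z <= h y -> z \in C)
          (closed_under C).
Proof.
apply: (iffP forallP) => [cC x y z xC yC xy zx zy | cC x].
  by have /forallP/(_ y)/forallP/(_ z) := cC x; rewrite xC yC xy zx zy.
apply/forallP => y; apply/forallP => z; apply/implyP.
by case/and5P; apply: cC.
Qed.

Record closed_set : predArgType := ClosedSet {
  closed_set_val :> {set X};
  closed_set_closed : closed_under closed_set_val }.

HB.instance Definition _ := [isSub for closed_set_val].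
HB.instance Definition _ := [Finite of closed_set by <:].

Lemma closed_setP (C : closed_set) x y z : x \in val C -> y \in val C ->
  x != y -> h z <= h x -> h z <= h y -> z \in val C.
Proof. by move: x y z; apply/closed_underP/(closed_set_closed C). Qed.

Fact closed_set_lt_def (A B : closed_set) :
  (A \proper B) = (B != A) && (A \subset B).
Proof. by rewrite properEneq eq_sym. Qed.

Fact closed_set_anti : antisymmetric (fun A B : closed_set => A \subset B).
Proof. by move=> A B; rewrite -eqEsubset => /eqP /val_inj. Qed.

HB.instance Definition _ := Order.isPOrder.Build incl_display closed_set
  closed_set_lt_def (fun A => subxx A) closed_set_anti
  (fun B A C => @subset_trans X A B C).

Lemma le_closed_set (A B : closed_set) : (A <= B) = (val A \subset val B).
Proof. by []. Qed.

(** The least closed set containing S. *)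
Definition closure_set (S : {set X}) : {set X} :=
  \bigcap_(C | closed_under C && (S \subset C)) C.

Lemma closure_set_closed S : closed_under (closure_set S).
Proof.
apply/closed_underP => x y z /bigcapP xC /bigcapP yC xy zx zy.
apply/bigcapP => C CS; have /andP[/closed_underP cC _] := CS.
exact: cC (xC _ CS) (yC _ CS) xy zx zy.
Qed.

Definition closure S : closed_set := ClosedSet (closure_set_closed S).

Lemma sub_closure (S : {set X}) : S \subset val (closure S).
Proof. by apply/bigcapsP => C /andP[]. Qed.

Lemma closure_le (S : {set X}) (C : closed_set) :
  (closure S <= C) = (S \subset val C).
Proof.
apply/idP/idP => [|SC]; first exact: subset_trans (sub_closure S).
by apply: bigcap_inf; rewrite closed_set_closed.
Qed.

Fact closed_set_meet_proof (A B : closed_set) : closed_under (A :&: B).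
Proof.
apply/closed_underP => x y z /setIP[xA xB] /setIP[yA yB] xy zx zy.
by rewrite inE (closed_setP xA yA) ?(closed_setP xB yB).
Qed.

Fact closed_set_lexI (A B C : closed_set) :
  (A <= ClosedSet (closed_set_meet_proof B C)) = (A <= B) && (A <= C).
Proof. by rewrite !le_closed_set subsetI. Qed.

Fact closed_set_leUx (A B C : closed_set) :
  (closure (val A :|: val B) <= C) = (A <= C) && (B <= C).
Proof. by rewrite closure_le subUset. Qed.

Fact closed_set_bottom_proof : closed_under set0.
Proof. by apply/closed_underP => x y z; rewrite inE. Qed.

Fact closed_set_top_proof : closed_under setT.
Proof. by apply/closed_underP => x y z; rewrite !inE. Qed.

Fact closed_set_le0x (A : closed_set) : ClosedSet closed_set_bottom_proof <= A.
Proof. by rewrite le_closed_set sub0set. Qed.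

Fact closed_set_lex1 (A : closed_set) : A <= ClosedSet closed_set_top_proof.
Proof. by rewrite le_closed_set subsetT. Qed.

HB.instance Definition _ :=
  Order.POrder_isMeetSemilattice.Build incl_display closed_set closed_set_lexI.
HB.instance Definition _ :=
  Order.POrder_isJoinSemilattice.Build incl_display closed_set closed_set_leUx.
HB.instance Definition _ :=
  Order.hasBottom.Build incl_display closed_set closed_set_le0x.
HB.instance Definition _ :=
  Order.hasTop.Build incl_display closed_set closed_set_lex1.

Lemma closed_set_meetE (A B : closed_set) : val (A `&` B) = val A :&: val B.
Proof. by []. Qed.

Lemma closed_set_joinE (A B : closed_set) :
  A `|` B = closure (val A :|: val B).
Proof. by []. Qed.

Fact point_proof x : closed_under [set x].
Proof.
by apply/closed_underP => y z t /set1P-> /set1P->; rewrite eqxx.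
Qed.

(** The points are the atoms of the lattice of closed sets. *)
Definition point x : closed_set := ClosedSet (point_proof x).

Lemma point_inj : injective point.
Proof. by move=> x y /(congr1 val)/set1_inj. Qed.

Lemma point_le x (C : closed_set) : (point x <= C) = (x \in val C).
Proof. by rewrite le_closed_set sub1set. Qed.

Lemma point_meet x (C : closed_set) :
  point x `&` C = if x \in val C then point x else \bot.
Proof.
apply/val_inj; rewrite closed_set_meetE.
case: ifPn => xC; first by apply/setIidPl; rewrite sub1set.
by apply/setP => y; rewrite !inE; case: eqP => // ->; apply/negbTE.
Qed.

Lemma le_point x (C : closed_set) : C <= point x -> C = \bot \/ C = point x.
Proof.
by rewrite le_closed_set subset1 => /orP[] /eqP Cx;
  [right | left]; apply: val_inj.
Qed.

Lemma closure_join (S : {set X}) : closure S = \join_(x in S) point x.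
Proof.
apply/le_anti/andP; split.
  by rewrite closure_le; apply/subsetP => x xS; rewrite -point_le joins_sup.
apply/joinsP => x xS; rewrite point_le.
exact: (subsetP (sub_closure S)).
Qed.

Lemma closure_id (C : closed_set) : closure (val C) = C.
Proof.
by apply/le_anti; rewrite closure_le subxx le_closed_set sub_closure.
Qed.

Lemma point_neq0 x : point x != \bot.
Proof.
by apply/eqP => /(congr1 val) /setP/(_ x); rewrite !inE eqxx.
Qed.

Lemma atom_point x : atom (point x).
Proof.
rewrite /atom /covers lt0x point_neq0 /=; apply/existsP => -[C /andP[]].
rewrite lt0x => C0 /[dup] /ltW /le_point[] CE; first by rewrite CE eqxx in C0.
by rewrite CE ltxx.
Qed.

Lemma closed_set_atomistic : atomistic closed_set.
Proof.
move=> C; exists (point @: val C).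
  by move=> _ /imsetP[x _ ->]; apply: atom_point.
rewrite big_imset /=; first by rewrite -closure_join closure_id.
by move=> x y _ _; apply: point_inj.
Qed.

Lemma join_irreducible_point x : join_irreducible (point x).
Proof.
rewrite /join_irreducible point_neq0 /=.
apply/forallP => A; apply/forallP => B; apply/implyP => /eqP xAB.
have Ax : A <= point x by rewrite xAB leUl.
have Bx : B <= point x by rewrite xAB leUr.
case: (le_point Ax) (le_point Bx) => [A0|->] [B0|->]; rewrite ?eqxx ?orbT //.
by have := point_neq0 x; rewrite xAB A0 B0 joinxx eqxx.
Qed.

Lemma joinirr_closed_set : joinirr closed_set = point @: X.
Proof.
apply/setP => C; rewrite inE; apply/idP/imsetP => [|[x _ ->]]; last first.
  exact: join_irreducible_point.
case/andP=> C0 /forallP Cirr.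
have: C = \join_(x <- enum (val C)) point x.
  by rewrite big_enum -closure_join closure_id.
elim: (enum _) => [|x s IHs]; first by rewrite big_nil => /eqP/(negP C0).
rewrite big_cons => /eqP Cxs.
have /forallP/(_ (\join_(y <- s) point y)) := Cirr (point x).
by rewrite Cxs /= => /orP[] /eqP; [move=> ->; exists x | apply: IHs].
Qed.

Lemma card_joinirr_closed_set : #|joinirr closed_set| = #|X|.
Proof. by rewrite joinirr_closed_set card_imset //; apply: point_inj. Qed.

(** * Congruences of the lattice of closed sets *)

Section Congruences.

(* No principal up-set of X has exactly two elements. *)
Hypothesis third : forall x y, x != y -> h x <= h y ->
  exists z, [/\ z != x, z != y & h x <= h z].

(** The points that r identifies with the bottom. *)
Definition collapsed (r : Con closed_set) x : bool := (point x, \bot) \in val r.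

(** With z a third point above x, the rule gives x <= y `|` z. If y is
    collapsed, then y `|` z is congruent to z, and meeting with x collapses
    x. *)
Lemma collapsed_le (r : Con closed_set) x y :
  h x <= h y -> collapsed r y -> collapsed r x.
Proof.
have [-> // | xy hxy ry] := eqVneq x y.
have [z [zx zy hxz]] := third xy hxy.
have /congruenceP[rr _ _ rI rU] := con_congruence r.
have ryz : (point y `|` point z, point z) \in val r.
  by have := rU _ _ _ _ ry (rr (point z)); rewrite join0x.
have := rI _ _ _ _ (rr (point x)) ryz.
rewrite !point_meet !inE [x == z]eq_sym (negbTE zx).
suff -> : x \in val (point y `|` point z) by [].
apply: (@closed_setP _ y z) => //; last by rewrite eq_sym.
  by rewrite -point_le leUl.
by rewrite -point_le leUr.
Qed.

(** Collapsed points can be dropped from a join, up to congruence. *)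
Lemma con_closure (r : Con closed_set) (S : {set X}) :
  (closure S, closure (S :\: [set x | collapsed r x])) \in val r.
Proof.
have /congruenceP[rr _ _ _ rU] := con_congruence r.
rewrite !closure_join.
have -> : \join_(x in S :\: [set x | collapsed r x]) point x =
          \join_(x in S) (if collapsed r x then \bot else point x).
  apply/le_anti/andP; split; apply/joinsP => x.
    by rewrite !inE => /andP[xr xS]; apply: (joins_min xS); rewrite (negbTE xr).
  by move=> xS; case: ifPn => // xr; apply: joins_sup; rewrite !inE xr.
elim/big_ind2: _ => [|A A' B B' rA rB|x xS]; [exact: rr|exact: rU|].
by case: ifPn.
Qed.

(** A congruence is determined by the points that it collapses. *)
Lemma con_collapsedE (r : Con closed_set) (A B : closed_set) :
  ((A, B) \in val r) = (val A :\: [set x | collapsed r x] ==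
                        val B :\: [set x | collapsed r x]).
Proof.
have /congruenceP[rr rs rt rI _] := con_congruence r.
apply/idP/eqP => [rAB | AB]; last first.
  rewrite -(closure_id A) -(closure_id B).
  apply: rt (con_closure r _) _; rewrite AB.
  exact/rs/con_closure.
have sub C D : (C, D) \in val r -> forall x, ~~ collapsed r x ->
    x \in val C -> x \in val D.
  move=> rCD x xr xC; apply: contraNT xr => xD; rewrite /collapsed.
  have := rI _ _ _ _ (rr (point x)) rCD.
  by rewrite !point_meet xC (negbTE xD).
apply/setP => x; rewrite !inE; case: (boolP (collapsed r x)) => //= xr.
by apply/idP/idP; apply: sub => //; apply: rs.
Qed.

(** Two closed sets are identified when they agree off the preimage of A. *)
Definition con_of_set (A : {set P}) : {set closed_set * closed_set} :=
  [set u | val u.1 :\: h @^-1: A == val u.2 :\: h @^-1: A].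

(** Off a down-set, the closure of S depends only on the part of S off that
    down-set: the down-set together with the closure of that part is already
    closed. *)
Lemma closure_mod (A : Hered P) (S : {set X}) :
  val (closure S) :\: h @^-1: A =
  val (closure (S :\: h @^-1: A)) :\: h @^-1: A.
Proof.
have /hereditaryP hA := downset_hereditary A.
have cU : closed_under (h @^-1: A :|: val (closure (S :\: h @^-1: A))).
  apply/closed_underP => x y z; rewrite 2!inE => xU.
  rewrite 2!inE => yU xy zx zy.
  rewrite 2!inE; case: (boolP (h z \in _)) => //= zA.
  have notA t : h z <= h t -> (h t \in downset_set A) = false.
    by move=> zt; apply: contraNF zA => tA; apply: hA tA zt.
  move: xU yU; rewrite !notA //= => xU yU.
  exact: (@closed_setP (closure _) x y z).
apply/eqP; rewrite eqEsubset; apply/andP; split; last first.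
  apply: setSD; rewrite -le_closed_set closure_le.
  exact: subset_trans (subsetDl _ _) (sub_closure S).
apply/subsetP => x /setDP[xS xA]; rewrite inE xA.
have: closure S <= ClosedSet cU.
  rewrite closure_le; apply/subsetP => y yS; rewrite inE.
  case: (boolP (y \in h @^-1: A)) => //= yA.
  by apply: (subsetP (sub_closure _)); rewrite inE yA.
rewrite le_closed_set => /subsetP/(_ x xS); rewrite inE (negbTE xA).
by [].
Qed.

Lemma con_of_set_congruence (A : Hered P) : congruence (con_of_set A).
Proof.
apply/congruenceP; split.
- by move=> C; rewrite inE.
- by move=> C D; rewrite !inE eq_sym.
- by move=> C D E; rewrite !inE => /eqP /= -> /eqP ->.
- move=> C C' D D'; rewrite !inE !closed_set_meetE !setDIl /=.
  by move=> /eqP-> /eqP->.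
- move=> C C' D D'; rewrite !closed_set_joinE !inE.
  move=> /eqP /= CC' /eqP /= DD'; apply/eqP.
  by rewrite closure_mod setDUl CC' DD' -setDUl -closure_mod.
Qed.

Definition con_of (A : Hered P) : Con closed_set :=
  Congruence (con_of_set_congruence A).

Lemma collapsed_con_of (A : Hered P) x :
  collapsed (con_of A) x = (h x \in downset_set A).
Proof.
rewrite /collapsed inE /= set0D; apply/eqP/idP => [/setP/(_ x)|xA].
  by rewrite !inE eqxx andbT => /negbFE.
apply/setP => y; rewrite !inE; apply/negP => /andP[yA /eqP yx].
by rewrite yx xA in yA.
Qed.

(* A section of h, so that h is onto and down-sets of X come from P. *)
Variable s : P -> X.
Hypothesis sK : cancel s h.

Fact hered_of_proof (r : Con closed_set) :
  hereditary [set p | collapsed r (s p)].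
Proof.
apply/hereditaryP => p q; rewrite !inE => rp qp.
by apply: collapsed_le rp; rewrite !sK.
Qed.

(** The down-set of P whose preimage under h is the set of collapsed points. *)
Definition hered_of (r : Con closed_set) : Hered P :=
  Downset (hered_of_proof r).

Lemma in_hered_of r x : (h x \in downset_set (hered_of r)) = collapsed r x.
Proof. by rewrite inE; apply/idP/idP; apply: collapsed_le; rewrite sK. Qed.

Lemma hered_ofK : cancel hered_of con_of.
Proof.
move=> r; apply/val_inj/setP => -[A B]; rewrite [RHS]con_collapsedE [LHS]inE /=.
by have -> : h @^-1: hered_of r = [set x | collapsed r x]
  by apply/setP => x; rewrite [LHS]inE [RHS]inE in_hered_of.
Qed.

Lemma con_ofK : cancel con_of hered_of.
Proof.
by move=> A; apply/val_inj/setP => p; rewrite inE collapsed_con_of sK.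
Qed.

Lemma hered_of_le r r' : (hered_of r <= hered_of r') = (r <= r').
Proof.
apply/idP/idP; rewrite leHered leCon => /subsetP rr'; last first.
  by apply/subsetP => p; rewrite !inE; apply: rr'.
apply/subsetP => -[A B]; rewrite !con_collapsedE => /eqP/setP AB.
apply/eqP/setP => x; have := AB x; rewrite !inE.
case: (boolP (collapsed r' x)) => //= xr'.
suff /negbTE-> : ~~ collapsed r x by [].
by apply: contra xr'; rewrite -!in_hered_of; apply: rr'.
Qed.

Lemma Con_closed_set_isomorphic : lattice_isomorphic (Con closed_set) (Hered P).
Proof.
exists hered_of; split=> [|r r'|r r'].
- by exists con_of; [apply: hered_ofK | apply: con_ofK].
- by apply/val_inj/setP => p; rewrite !inE /collapsed [LHS]inE.
- apply/le_anti/andP; split; last by rewrite leUx !hered_of_le leUl leUr.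
  (* An order isomorphism preserves least upper bounds. *)
  rewrite -[leRHS]con_ofK hered_of_le leUx -!(hered_of_le _ (con_of _)) con_ofK.
  by rewrite leUl leUr.
Qed.

End Congruences.
End ClosedSets.

(** * Blowing up a poset along its spikes *)

Section Blowup.
Context {d : Order.disp_t}.
Variable P : finPOrderType d.

(** The number of extra copies of p: one if <p, q> is the only spike ending in
    q for some q, and two if several spikes end in p. The sum
    is at most 1, since the q of a spike is determined by p; the two cases are
    exclusive as well, but the proofs need neither fact. *)
Definition excess (p : P) : nat :=
  (\sum_(q in partial_u P) spike p q + 2 * (p \in partial_m P))%N.

(** The set of all copies of the elements of P, tagged by the element copied. *)
Definition blowup : finType := {p : P & 'I_(excess p).+1}.

Definition blowup_base (p : P) : blowup :=
  @Tagged P p (fun p => 'I_(excess p).+1) ord0.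

Lemma card_blowup : #|blowup| = (#|P| + alpha P)%N.
Proof.
rewrite card_tagged sumnE big_map big_enum /=.
under eq_bigr do rewrite card_ord -addn1 addnC.
rewrite big_split /= sum1_card big_split /=; congr (_ + (_ + _))%N.
  rewrite exchange_big /= -sum1_card; apply: eq_bigr => q.
  rewrite inE => /eqP <-.
  by rewrite -sum1dep_card [RHS]big_mkcond; apply: eq_bigr => p _; case: spike.
by rewrite -big_distrr /= -sum1_card [in RHS]big_mkcond; congr (2 * _)%N.
Qed.

Lemma fibre_escape (p : P) (S : {set blowup}) : (#|S| <= excess p)%N ->
  exists2 z : blowup, z \notin S & tag z = p.
Proof.
move=> Sp; pose t : 'I_(excess p).+1 -> blowup :=
  @Tagged P p (fun p => 'I_(excess p).+1).
have tI : injective t.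
  apply: (can_inj (g := tagged_as (t ord0))) => i.
  by rewrite (tagged_asE (u := t ord0)).
have /subsetPn[z /imsetP[i _ ->] zS] :
    ~~ ([set t i | i in 'I_(excess p).+1] \subset S).
  apply: contraL Sp => /subset_leq_card; rewrite card_imset // card_ord.
  by rewrite ltnNge.
by exists (t i).
Qed.

(** A two-element principal up-set comes from a spike. *)
Lemma spike_of_above (p q : P) :
  p < q -> (forall r, p < r -> r = q) -> spike p q.
Proof.
move=> pq above; apply/and3P; split.
- apply/existsP => -[r qr]; move: (qr).
  by rewrite (above r) ?ltxx // (lt_trans pq qr).
- rewrite /covers pq; apply/existsP => -[r /andP[pr]].
  by rewrite (above r pr) ltxx.
- by apply/forallP => r; apply/implyP => /andP[/above->].
Qed.

Lemma excess_gt0 (p : P) : (0 < excess p)%N ->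
  p \in partial_m P \/ exists q, spike p q.
Proof.
rewrite /excess; case: (p \in partial_m P); first by left.
rewrite muln0 addn0 lt0n sum_nat_eq0 negb_forall => /existsP[q].
rewrite negb_imply => /andP[_].
by case: (boolP (spike p q)) => // pq _; right; exists q.
Qed.

Lemma excess_partial_m (p : P) : p \in partial_m P -> (2 <= excess p)%N.
Proof. by move=> pm; rewrite /excess pm muln1 leq_addl. Qed.

Lemma excess_spike_u (p q : P) :
  q \in partial_u P -> spike p q -> (0 < excess p)%N.
Proof. by move=> qu pq; rewrite /excess (bigD1 q) //= pq. Qed.

(** No principal up-set of the blow-up has exactly two elements. *)
Lemma blowup_third (x y : blowup) : x != y -> tag x <= tag y ->
  exists z, [/\ z != x, z != y & tag x <= tag z].
Proof.
move=> xy; have xy2 : (#|[set x; y]| <= 2)%N by rewrite cards2; case: (x != y).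
have escape p : (2 <= excess p)%N -> tag x <= p ->
    exists z, [/\ z != x, z != y & tag x <= tag z].
  move=> p2 xp; have [z] := fibre_escape (leq_trans xy2 p2).
  by rewrite !inE negb_or => /andP[zx zy] zp; exists z; rewrite zp.
have above r : tag x < r -> r != tag y ->
    exists z, [/\ z != x, z != y & tag x <= tag z].
  move=> xr ry; exists (blowup_base r); split; last exact: ltW.
    by apply: contraTneq xr => <-; rewrite ltxx.
  by apply: contraNneq ry => <-.
rewrite le_eqVlt => /orP[/eqP xyt | xyt].
  (* Distinct copies of the same element: either it has a third copy, or it
     lies below some q in a spike, and a copy of q will do. *)
  have : (0 < excess (tag x))%N.
    case: x y {xy2 escape above} xy xyt => p i [q j] /= xy pq.
    case: q / pq j xy => j.
    apply: contraNT; rewrite -eqn0Ngt => /eqP p0.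
    suff -> : i = j by [].
    have zero (k : 'I_(excess p).+1) : val k = 0%N.
      apply/eqP; rewrite -leqn0 (leq_trans (n := excess p)) ?p0 //.
      by rewrite -ltnS ltn_ord.
    by apply: val_inj; rewrite !zero.
  case/excess_gt0 => [xm | [q /and3P[_ /andP[xq _] _]]].
    by apply: escape (excess_partial_m xm) _.
  apply: (above q) => //; rewrite -xyt.
  by apply: contraTneq xq => ->; rewrite ltxx.
have [/existsP[r /andP[xr ry]]|/existsPn none] :=
    boolP [exists r, (tag x < r) && (r != tag y)].
  exact: above xr ry.
(* Only tag y lies strictly above tag x, so they form a spike. The third point
   is another copy of tag x if this is the only spike of tag y, and another
   copy of tag y otherwise. *)
have xys : spike (tag x) (tag y).
  apply: spike_of_above => // r xr; have := none r.
  by rewrite xr /= negbK => /eqP.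
have [yu | yu] := boolP (tag y \in partial_u P); last first.
  apply: (escape (tag y)); last exact: ltW.
  apply: excess_partial_m; rewrite !inE in yu *; rewrite yu.
  by apply/existsP; exists (tag x).
have [|z] := @fibre_escape (tag x) [set x].
  by rewrite cards1; apply: excess_spike_u xys.
rewrite inE => zx zt; exists z; split=> //; last by rewrite zt.
by apply: contraTneq xyt => <-; rewrite zt ltxx.
Qed.

End Blowup.

Theorem theorem5p3 (d : Order.disp_t) (P : finPOrderType d) :
  exists (d' : Order.disp_t) (L : finTBLatticeType d'),
    [/\ atomistic L,
        lattice_isomorphic (Con L) (Hered P) &
        #|joinirr L| = (#|P| + alpha P)%N].
Proof.
pose h (x : blowup P) : P := tag x.
exists incl_display, (closed_set h); split.
- exact: closed_set_atomistic.
- exact: (@Con_closed_set_isomorphic _ _ _ h (@blowup_third _ P)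
    (@blowup_base _ P)).
- by rewrite card_joinirr_closed_set card_blowup.
Qed.
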